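(* Let $F$ be a field and let $A$ be an $F$-algebra (not necessarily associative, commutative or unital) which is generated as an algebra by two distinct nonzero primitive axes $a$ and $b$, where $a$ is of type $(\lambda,\delta)$ and $b$ is of type $(\lambda',\delta')$, with $\lambda,\delta,\lambda',\delta'\in F\setminus\{0,1\}$. Then: (1) If $ab\in Fa+Fb$, then $\dim_F(A)=2$. (2) If $ab=0$, then $ba=0$.
   Context: For $a\in A$ let $L_a(x)=ax$ and $R_a(x)=xa$ $(x\in A)$. For $\mu\in F$ put $A_\mu(L_a)=\{v\in A: av=\mu v\}$ and $A_\mu(R_a)=\{v\in A: va=\mu v\}$; these may be $0$. Let $\lambda,\delta\in F\setminus\{0,1\}$. An idempotent $a\in A$ ($a^2=a$) is a primitive axis of type $(\lambda,\delta)$ if all of the following hold: (1) $(L_a-\lambda)(L_a-1)L_a=0$, $A_1(L_a)=Fa$, and the decomposition $A=A^+\oplus A^-$ with $A^+=Fa\oplus A_0(L_a)$, $A^-=A_\lambda(L_a)$ is a $\mathbb{Z}_2$-grading (i.e. $A^+A^+\subseteq A^+$, $A^+A^-\subseteq A^-$, $A^-A^+\subseteq A^-$, $A^-A^-\subseteq A^+$); (2) $(R_a-\delta)(R_a-1)R_a=0$, $A_1(R_a)=Fa$, and the decomposition $A=(Fa\oplus A_0(R_a))\oplus A_\delta(R_a)$ is likewise a $\mathbb{Z}_2$-grading with even part $Fa\oplus A_0(R_a)$ and odd part $A_\delta(R_a)$; (3) $L_aR_a=R_aL_a$. *)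

(* Defs.v *)
(* MathComp *)
From mathcomp Require Import all_boot all_order all_algebra.

Set Implicit Arguments.
Unset Strict Implicit.
Unset Printing Implicit Defensive.

Import GRing.Theory.
Local Open Scope ring_scope.

(* An F-algebra, not necessarily associative, commutative or unital, is an
   lmodType F (of arbitrary dimension) with a bilinear product. MathComp's
   lalgType and algType are associative and unital. *)

(* Vector.axiom n V is the type of linear bijections from V to 'rV_n; the
   dimension \dim of vector.v is not available on a mere lmodType. *)
Definition has_dim (F : fieldType) (n : nat) (V : lmodType F) : Prop :=
  inhabited (Vector.axiom n V).

Section Axes.

Variables (F : fieldType) (A : lmodType F) (mul : {bilinear A -> A -> A}).

Implicit Types (U V : A -> Prop) (f : A -> A) (a b v x : A) (mu c : F).

Definition Lmul a x : A := mul a x.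
Definition Rmul a x : A := mul x a.

Definition line a x : Prop := exists c, x = c *: a.
Definition eigen f mu v : Prop := f v = mu *: v.

Definition sum_set U V x : Prop := exists u v, [/\ U u, V v & x = u + v].
Definition independent U V : Prop := forall x, U x -> V x -> x = 0.
Definition mul_sub U V W : Prop := forall u v, U u -> V v -> W (mul u v).

Record Z2_grading (E O : A -> Prop) : Prop := {
  grading_total : forall x, sum_set E O x;
  grading_direct : independent E O;
  grading_even_even : mul_sub E E E;
  grading_even_odd : mul_sub E O O;
  grading_odd_even : mul_sub O E O;
  grading_odd_odd : mul_sub O O E
}.

Definition minus_scalar f c x : A := f x - c *: x.

(* The condition on one side of an axis: f is Lmul a or Rmul a. *)
Record one_sided_axis f a mu : Prop := {
  axis_annihilated : forall x, minus_scalar f mu (minus_scalar f 1 (f x)) = 0;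
  axis_primitive : forall v, eigen f 1 v <-> line a v;
  axis_even_direct : independent (line a) (eigen f 0);
  axis_grading : Z2_grading (sum_set (line a) (eigen f 0)) (eigen f mu)
}.

Record primitive_axis a (lambda delta : F) : Prop := {
  axis_idempotent : mul a a = a;
  axis_left : one_sided_axis (Lmul a) a lambda;
  axis_right : one_sided_axis (Rmul a) a delta;
  axis_comm : forall x, Lmul a (Rmul a x) = Rmul a (Lmul a x)
}.

Record subalgebra (S : A -> Prop) : Prop := {
  subalgebra0 : S 0;
  subalgebraD : forall x y, S x -> S y -> S (x + y);
  subalgebraZ : forall c x, S x -> S (c *: x);
  subalgebraM : forall x y, S x -> S y -> S (mul x y)
}.

Definition generated_by a b : Prop :=
  forall S : A -> Prop, subalgebra S -> S a -> S b -> forall x, S x.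

End Axes.

(* Main.v *)
Require Import Defs.
From mathcomp Require Import all_boot all_order all_algebra.

Set Implicit Arguments.
Unset Strict Implicit.
Unset Printing Implicit Defensive.

Import GRing.Theory.
Local Open Scope ring_scope.

(** Write b = e + o with e even and o odd for one of the gradings attached to
    the axis a. The odd part of b b = b reads o = e o + o e.
    If a b = 0, then c := b a is odd for R_a, b c = lambda' c and c b = 0, and
    the odd equation becomes (1 - lambda') c = -2 delta^-1 c c, where the left
    side is odd and the right side is even; hence c = 0.
    If a b = alpha a + beta b with beta <> 0, then e = rho a with rho <> 0, so
    the odd equation puts a o + o a, and with it b a, in F a + F b. The case
    alpha <> 0 is symmetric, so F a + F b is always a subalgebra. *)

Section OneSidedAxis.

Variables (F : fieldType) (A : lmodType F) (mul : {bilinear A -> A -> A}).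
Variables (f : {linear A -> A}) (a : A) (mu : F).
Hypothesis axf : one_sided_axis mul f a mu.

Let E := sum_set (line a) (eigen f 0).
Let O := eigen f mu.

Lemma axis_fixed : f a = a.
Proof.
suff: eigen f 1 a by rewrite /eigen scale1r.
by apply/(axis_primitive axf); exists 1; rewrite scale1r.
Qed.

Lemma axis_even_linear c x y : E x -> E y -> E (c *: x + y).
Proof.
move=> [_ [v [[r ->] fv ->]]] [_ [w [[s ->] fw ->]]].
exists ((c * r + s) *: a), (c *: v + w); split; first by exists (c * r + s).
- by rewrite /eigen linearP fv fw !scale0r scaler0 addr0.
- by rewrite scalerDl scalerDr scalerA addrACA.
Qed.

Lemma axis_odd_linear c x y : O x -> O y -> O (c *: x + y).
Proof. by rewrite /O /eigen linearP => -> ->; rewrite scalerDr !scalerA mulrC. Qed.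

Lemma axis_even0 : E 0.
Proof.
exists 0, 0; split; rewrite ?addr0 //; first by exists 0; rewrite scale0r.
by rewrite /eigen linear0 scale0r.
Qed.

Lemma axis_odd0 : O 0.
Proof. by rewrite /O /eigen linear0 scaler0. Qed.

Lemma axis_evenZ c x : E x -> E (c *: x).
Proof. by move=> Ex; rewrite -[c *: x]addr0; apply: axis_even_linear axis_even0. Qed.

Lemma axis_oddZ c x : O x -> O (c *: x).
Proof. by move=> Ox; rewrite -[c *: x]addr0; apply: axis_odd_linear axis_odd0. Qed.

Lemma axis_even_line c : E (c *: a).
Proof.
exists (c *: a), 0; split; rewrite ?addr0 //; first by exists c.
by rewrite /eigen linear0 scale0r.
Qed.

Lemma axis_even_ker x : f x = 0 -> E x.
Proof.
move=> fx; exists 0, x; split; rewrite ?add0r //; last by rewrite /eigen fx scale0r.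
by exists 0; rewrite scale0r.
Qed.

Lemma axis_even_odd0 x : E x -> O x -> x = 0.
Proof. exact: (grading_direct (axis_grading axf)). Qed.

Lemma axis_decomposition b :
  exists r v o, [/\ f v = 0, f o = mu *: o & b = r *: a + v + o].
Proof.
have [_ [o [[_ [v [[r ->] fv ->]]] fo ->]]] := grading_total (axis_grading axf) b.
by exists r, v, o; split; rewrite // fv scale0r.
Qed.

Lemma idempotent_odd_part e o : E e -> O o ->
  mul (e + o) (e + o) = e + o -> o = mul e o + mul o e.
Proof.
move=> Ee Oo idem; have gr := axis_grading axf.
have Eeven: E (e - (mul e e + mul o o)).
  rewrite addrC -scaleN1r; apply: axis_even_linear => //.
  rewrite -[mul e e]scale1r; apply: axis_even_linear.
    exact: (grading_even_even gr).
  exact: (grading_odd_odd gr).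
have Oodd: O (mul e o + mul o e - o).
  rewrite addrC -scaleN1r; apply: axis_odd_linear => //.
  rewrite -[mul e o]scale1r; apply: axis_odd_linear.
    exact: (grading_even_odd gr).
  exact: (grading_odd_even gr).
(* Rearranged idempotency: the left side is odd and the right side even, so both vanish. *)
have balance: mul e o + mul o e - o = e - (mul e e + mul o o).
  apply/eqP; rewrite subr_eq [_ - _ + o]addrAC eq_sym subr_eq -idem.
  by rewrite linearDl !linearDr /= [mul o e + _]addrC addrACA addrC.
by apply/esym/eqP; rewrite -subr_eq0; apply/eqP/axis_even_odd0; rewrite // balance.
Qed.

(** With [b = r *: a + v + o], [f b = r *: a + mu *: o]. As [g] commutes with [f], it preserves the
    odd part and kills [f b]; as it fixes [a], this makes [r *: a = - mu *: g o] both even and odd.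
    The pair [f], [g] is meant to be the two multiplications by one axis. *)
Lemma axis_image_odd (g : {linear A -> A}) b :
  g a = a -> (forall x, g (f x) = f (g x)) -> g b = 0 -> O (f b).
Proof.
move=> ga gf gb; have [r [v [o [fv fo bE]]]] := axis_decomposition b.
have fbE: f b = r *: a + mu *: o.
  by rewrite bE !linearD fv linearZ /= axis_fixed fo addr0.
have Og: O (g o) by rewrite /O /eigen -gf fo linearZ.
have ra0: r *: a = 0.
  apply: axis_even_odd0; first exact: axis_even_line.
  have /eqP: g (f b) = 0 by rewrite gf gb linear0.
  rewrite fbE linearD !linearZ /= ga addr_eq0 => /eqP ->.
  by rewrite -scaleNr; apply: axis_oddZ.
by rewrite fbE ra0 add0r; apply: axis_oddZ.
Qed.

Lemma odd_image_eq0 b nu : mu != 0 -> nu != 1 -> mul b b = b -> O (f b) ->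
  mul b (f b) = nu *: f b -> mul (f b) b = 0 -> f b = 0.
Proof.
move=> mu0 nu1 idem; set c := f b => Oc bc cb.
(* Since [f c = mu *: c], this difference is killed by [f]; so the odd part of [b] is
   [mu^-1 *: c]. *)
have Ee: E (b - mu^-1 *: c).
  by apply: axis_even_ker; rewrite linearB linearZ /= Oc scalerA mulVf // scale1r subrr.
have /idempotent_odd_part : O (mu^-1 *: c) by apply: axis_oddZ.
move=> /(_ _ Ee); rewrite subrK => /(_ idem).
rewrite linearZr_LR linearZl_LR /= -scalerDr => /(scalerI (invr_neq0 mu0)).
rewrite linearBl linearBr /= linearZl_LR linearZr_LR /= bc cb sub0r => cE.
have Ecc: E (mul c c) by apply: (grading_odd_odd (axis_grading axf)).
have c1: (1 - nu) *: c = (- (mu^-1 + mu^-1)) *: mul c c.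
  apply/eqP; rewrite scalerBl scale1r subr_eq {1}cE scaleNr scalerDl opprD.
  by rewrite -addrA addrC.
have /eqP: (1 - nu) *: c = 0.
  apply: axis_even_odd0; last exact: axis_oddZ.
  by rewrite c1; apply: axis_evenZ.
by rewrite scaler_eq0 subr_eq0 eq_sym (negPf nu1) => /eqP.
Qed.

(** Here [f] may be left or right multiplication by [a], and the conclusion is symmetric in the two
    products, so one statement serves [mul a b] read as either [L_a b] or [R_b a]. *)
Lemma anticommutator_span b alpha beta : mul a a = a -> mul b b = b -> b <> 0 ->
  ~ line a b -> f b = alpha *: a + beta *: b -> beta != 0 ->
  sum_set (line a) (line b) (mul a b + mul b a).
Proof.
move=> aa idem b0 nab fb beta0; have [r [v [o [fv fo bE]]]] := axis_decomposition b.
have Er := axis_even_line.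
(* Compare the two values of [f b], namely [r *: a + mu *: o] and
   [alpha *: a + beta *: (r *: a + v + o)]: the even and odd components must agree separately. *)
have v_line: beta *: v = (r - beta * r - alpha) *: a.
  apply/eqP; rewrite eq_sym -subr_eq0; apply/eqP.
  have balance: (r - beta * r - alpha) *: a - beta *: v = (beta - mu) *: o.
    have /(canRL (addrK _)) raE: r *: a + mu *: o = alpha *: a + beta *: b.
      by rewrite -fb bE !linearD fv linearZ /= axis_fixed fo addr0.
    apply/eqP; rewrite !scalerBl !subr_eq raE bE !scalerDr scalerA !addrA.
    by rewrite [X in X == _](ACl (4*5*3*1*2)).
  apply: axis_even_odd0; last by rewrite balance; apply: axis_oddZ.
  rewrite addrC -scaleNr; apply: axis_even_linear; last exact: Er.
  exact: axis_even_ker.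
have v0: v = 0.
  apply: (axis_even_direct axf); last by rewrite /eigen fv scale0r.
  exists (beta^-1 * (r - beta * r - alpha)).
  by rewrite -scalerA -v_line scalerA mulVf // scale1r.
rewrite v0 addr0 in bE.
have oE: o = mul (r *: a) o + mul o (r *: a).
  by apply: idempotent_odd_part; rewrite // -bE.
have r0: r != 0.
  apply/eqP => r0; apply: b0; rewrite bE r0 scale0r add0r oE r0 scale0r.
  by rewrite linear0l linear0r addr0.
have {}oE: mul a o + mul o a = r^-1 *: o.
  by rewrite {3}oE linearZl_LR linearZr_LR /= -scalerDr scalerA mulVf // scale1r.
have oE' : o = b - r *: a by rewrite bE addrC addKr.
(* Expanding [b = r *: a + o] gives the anticommutator [(r + r) *: a + r^-1 *: o], and
   [o = b - r *: a]. *)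
exists ((r + r - 1) *: a), (r^-1 *: b); split; [by exists (r + r - 1)|by exists r^-1|].
rewrite {1 2}bE linearDl linearDr /= linearZl_LR linearZr_LR /= aa addrACA oE -scalerDl.
by rewrite oE' scalerBr scalerA mulVf // scale1r scalerBl addrA addrAC scale1r.
Qed.

End OneSidedAxis.

(** If [b = k *: a], idempotency forces [(k * (k - 1)) *: a = 0], so [b] is [0] or [a]. *)
Lemma idempotent_notin_line (F : fieldType) (A : lmodType F)
    (mul : {bilinear A -> A -> A}) (a b : A) :
  mul a a = a -> mul b b = b -> b <> 0 -> a <> b -> ~ line a b.
Proof.
move=> aa bb b0 ab [k bE]; move: bb; rewrite bE linearZl_LR linearZr_LR /= aa => /eqP.
rewrite -subr_eq0 scalerA -scalerBl -{3}[k]mulr1 -mulrBr scaler_eq0 mulf_eq0 subr_eq0.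
case/orP => [/orP[]|] /eqP h.
- by apply: b0; rewrite bE h scale0r.
- by apply: ab; rewrite bE h scale1r.
- by apply: b0; rewrite bE h scaler0.
Qed.

(** The coordinate map must go out of [V]. Preimages under [h] are picked by [xchoose], since row
    vectors form a choice type and [h r == x] is boolean. *)
Lemma has_dim_linear_bij (F : fieldType) (n : nat) (V : lmodType F)
    (h : 'rV[F]_n -> V) :
  linear h -> injective h -> (forall x, exists r, h r = x) -> has_dim n V.
Proof.
move=> hlin hinj hsurj.
have hsurjb x : exists r, h r == x by have [r <-] := hsurj x; exists r.
pose k x := xchoose (hsurjb x).
have hk : cancel k h by move=> x; apply/eqP/(xchooseP (hsurjb x)).
constructor; exists k; first by move=> c x y; apply: hinj; rewrite hlin !hk.
by exists h => // r; apply: hinj; rewrite hk.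
Qed.

Lemma has_dim2 (F : fieldType) (V : lmodType F) (a b : V) :
  a <> 0 -> ~ line a b -> (forall x, sum_set (line a) (line b) x) -> has_dim 2 V.
Proof.
move=> a0 nab span.
pose h (r : 'rV[F]_2) := r 0 0 *: a + r 0 1 *: b.
have hlin : linear h.
  move=> c r s; rewrite /h !mxE !scalerDl scalerDr !scalerA.
  exact: addrACA.
have hker r : h r = 0 -> r = 0.
  rewrite /h => hr.
  have r1 : r 0 1 = 0.
    apply/eqP/negP => /negP r1; apply: nab; exists (- (r 0 1)^-1 * r 0 0).
    move/eqP: hr; rewrite addrC addr_eq0 => /eqP hr.
    by rewrite mulNr scaleNr -scalerA -scalerN -hr scalerA mulVf // scale1r.
  have r0 : r 0 0 = 0.
    move/eqP: hr; rewrite r1 scale0r addr0 scaler_eq0 => /orP[] /eqP //.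
  apply/rowP => i; rewrite mxE; case: i => [[|[|i]] lti] //.
    by rewrite -[RHS]r0; congr (r _ _); apply: val_inj.
  by rewrite -[RHS]r1; congr (r _ _); apply: val_inj.
apply: (has_dim_linear_bij hlin) => [r s hrs|x].
  apply/esym/eqP; rewrite -subr_eq0; apply/eqP/hker.
  by rewrite addrC -scaleN1r hlin hrs scaleN1r addNr.
have [_ [_ [[c ->] [d ->] ->]]] := span x.
by exists (\row_i if i == 0 then c else d); rewrite /h !mxE.
Qed.

Lemma line_sum_linear (F : fieldType) (A : lmodType F) (a b : A) c x y :
  sum_set (line a) (line b) x -> sum_set (line a) (line b) y ->
  sum_set (line a) (line b) (c *: x + y).
Proof.
move=> [_ [_ [[r ->] [s ->] ->]]] [_ [_ [[t ->] [u ->] ->]]].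
exists ((c * r + t) *: a), ((c * s + u) *: b); split; [by eexists|by eexists|].
by rewrite !scalerDl scalerDr !scalerA addrACA.
Qed.

(** By bilinearity, the four products of [a] and [b] lying in the span make it a subalgebra
    containing the generators. *)
Lemma line_sum_total (F : fieldType) (A : lmodType F)
    (mul : {bilinear A -> A -> A}) (a b : A) :
  let S := sum_set (line a) (line b) in
  generated_by mul a b -> mul a a = a -> mul b b = b -> S (mul a b) -> S (mul b a) ->
  forall x, S x.
Proof.
move=> S gen aa bb Sab Sba.
have Sa : S a.
  by exists a, 0; split; [exists 1|exists 0|]; rewrite ?scale1r ?scale0r ?addr0.
have Sb : S b.
  by exists 0, b; split; [exists 0|exists 1|]; rewrite ?scale1r ?scale0r ?add0r.
have S0 : S 0 by rewrite -[0](addNr a) -scaleN1r; apply: line_sum_linear.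
have SD x y : S x -> S y -> S (x + y).
  by move=> Sx Sy; rewrite -[x]scale1r; apply: line_sum_linear.
have SZ c x : S x -> S (c *: x).
  by move=> Sx; rewrite -[c *: x]addr0; apply: line_sum_linear.
apply: (gen S _ Sa Sb); split=> // _ _ [_ [_ [[r ->] [s ->] ->]]] [_ [_ [[t ->] [u ->] ->]]].
rewrite linearDl !linearDr /= !linearZl_LR !linearZr_LR /= aa bb.
by do 2!apply: (SD _ _); do 2!apply: (SZ _ _).
Qed.

Theorem propositionC (F : fieldType) (A : lmodType F)
    (mul : {bilinear A -> A -> A}) (a b : A) (lambda delta lambda' delta' : F)
    (hlambda : lambda <> 0 /\ lambda <> 1)
    (hdelta : delta <> 0 /\ delta <> 1)
    (hlambda' : lambda' <> 0 /\ lambda' <> 1)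
    (hdelta' : delta' <> 0 /\ delta' <> 1)
    (ha0 : a <> 0) (hb0 : b <> 0) (hab : a <> b)
    (ha : primitive_axis mul a lambda delta)
    (hb : primitive_axis mul b lambda' delta')
    (hgen : generated_by mul a b) :
  (sum_set (line a) (line b) (mul a b) -> has_dim 2 A)
  /\ (mul a b = 0 -> mul b a = 0).
Proof.
have [aa aL aR acomm] := ha; have [bb bL bR bcomm] := hb.
have part2 : mul a b = 0 -> mul b a = 0.
  move=> ab; apply: (odd_image_eq0 (f := applyr mul a) aR (b := b) (nu := lambda')) => //.
  - by apply/eqP; case: hdelta.
  - by apply/eqP; case: hlambda'.
  (* [L_a] kills [b], so [R_a b] is odd for [R_a]. Next, [R_b] kills [a], so [L_b a] is a
     [lambda']-eigenvector of [L_b]. Finally [(b a) b = b (a b) = 0]. *)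
  - apply: (axis_image_odd (f := applyr mul a) aR (g := mul a)) => //.
  - apply: (axis_image_odd (f := mul b) bL (g := applyr mul b)) => //.
    by move=> x; rewrite -[LHS]bcomm.
  - by rewrite -[LHS]bcomm /Lmul /Rmul ab linear0r.
split=> // abS.
have nab := idempotent_notin_line aa bb hb0 hab.
have nba := idempotent_notin_line bb aa ha0 (not_eq_sym hab).
apply: (has_dim2 ha0 nab); apply: (line_sum_total hgen) => //.
suff abbaS : sum_set (line a) (line b) (mul a b + mul b a).
  rewrite -[mul b a](addKr (mul a b)) -scaleN1r; exact: line_sum_linear.
have [_ [_ [[alpha ->] [beta ->] abE]]] := abS.
have [beta0|beta0] := eqVneq beta 0; last first.
  exact: (anticommutator_span (f := mul a) aL aa bb hb0 nab abE beta0).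
have [alpha0|alpha0] := eqVneq alpha 0.
  have ab : mul a b = 0 by rewrite abE alpha0 beta0 !scale0r addr0.
  by rewrite part2 // addr0.
(* Read as [R_b a = alpha *: a + beta *: b], the relation allows the roles of [a] and [b] to be
   exchanged. *)
rewrite addrC in abE.
have [x [y [bx ay baE]]] :=
  anticommutator_span (f := applyr mul b) bR bb aa ha0 nba abE alpha0.
by exists y, x; split; rewrite // addrC baE addrC.
Qed.
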